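(* Let $p\geq3$ and $\lambda=\lambda_p=2\cos(\pi/p)$. Suppose that $\alpha$ is a $G_p$-simple number with Hecke conjugate $\alpha'$. Then $S^n\alpha=\alpha+n\lambda$, with $n=-\lfloor\alpha'/\lambda\rfloor$, is a $G_p$-reduced number. Moreover, the set of $G_p$-simple numbers equals $$\mathcal{Z}=\left\{S^{-i}\beta=\beta-i\lambda \;\middle|\; \beta \text{ is } G_p\text{-reduced},\ 1\le i\le \lfloor\beta/\lambda\rfloor\right\}.$$
   Context: Let $S=\begin{pmatrix}1&\lambda\\0&1\end{pmatrix}$, $T=\begin{pmatrix}0&-1\\1&0\end{pmatrix}$, $G_p=\langle S,T\rangle/\{\pm I\}$ acting by linear fractional transformations. A hyperbolic fixed point is a real number fixed by an element of $G_p$ with $|{\rm trace}|>2$; its Hecke conjugate is the other fixed point of the elements of its stabilizer. For a $\lambda$-BQF $Q=[A,B,C]$ ($A,B,C\in\mathbb{Z}[\lambda]$, $D=B^2-4AC>0$), $\alpha_Q=\frac{-B+\sqrt D}{2A}$. Hyperbolic forms are those of the form $Q_\alpha=[c,d-a,-b]$, $\alpha$ a hyperbolic fixed point and $\begin{pmatrix}a&b\\c&d\end{pmatrix}$ a generator of its stabilizer chosen up to inversion so that $\alpha=\frac{a-d+\sqrt{(a+d)^2-4}}{2c}$. A hyperbolic form $[A,B,C]$ is $G_p$-simple if $A>0>C$, and a $G_p$-simple number is $\alpha_Q$ for a $G_p$-simple form $Q$. The $\lambda$-continued fraction of real $x$: $x_0=x$, $r_j=\lfloor x_j/\lambda\rfloor+1$,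 $x_{j+1}=\frac1{r_j\lambda-x_j}$. A real number is $G_p$-reduced if its $\lambda$-continued fraction is purely periodic with period other than $(2,1,\dots,1)$ ($p-3$ ones). *)

(* Defs.v *)
From Stdlib Require Import Reals ZArith List.
Open Scope R_scope.

Definition lam (p : nat) : R := 2 * cos (PI / INR p).

Definition Rfloor (x : R) : Z := (up x - 1)%Z.

Definition in_Zlam (l x : R) : Prop :=
  exists cs : list Z,
    x = fold_right (fun c acc => IZR c + l * acc) 0 cs.

Record Mat := mkMat { ma : R; mb : R; mc : R; md : R }.

Definition mmul (g h : Mat) : Mat :=
  mkMat (ma g * ma h + mb g * mc h) (ma g * mb h + mb g * md h)
        (mc g * ma h + md g * mc h) (mc g * mb h + md g * md h).
Definition mid : Mat := mkMat 1 0 0 1.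
Definition mopp (g : Mat) : Mat := mkMat (- ma g) (- mb g) (- mc g) (- md g).
(* inverse of a determinant-one matrix *)
Definition minv (g : Mat) : Mat := mkMat (md g) (- mb g) (- mc g) (ma g).
Fixpoint mpow (g : Mat) (n : nat) : Mat :=
  match n with O => mid | S n => mmul g (mpow g n) end.
Definition mpowZ (g : Mat) (k : Z) : Mat :=
  if (0 <=? k)%Z then mpow g (Z.to_nat k) else mpow (minv g) (Z.to_nat (- k)).
Definition mtrace (g : Mat) : R := ma g + md g.

Definition Smat (p : nat) : Mat := mkMat 1 (lam p) 0 1.
Definition Tmat : Mat := mkMat 0 (-1) 1 0.

(* the matrix group <S,T> (its image mod {+-I} is the Hecke group G_p) *)
Inductive in_Gp (p : nat) : Mat -> Prop :=
| Gp_id : in_Gp p mid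
| Gp_S : in_Gp p (Smat p)
| Gp_Sinv : in_Gp p (minv (Smat p))
| Gp_T : in_Gp p Tmat
| Gp_Tinv : in_Gp p (minv Tmat)
| Gp_mul : forall g h, in_Gp p g -> in_Gp p h -> in_Gp p (mmul g h).

Definition fixes (g : Mat) (x : R) : Prop :=
  mc g * x + md g <> 0 /\ (ma g * x + mb g) / (mc g * x + md g) = x.

Definition hyperbolic_fixed_point (p : nat) (x : R) : Prop :=
  exists g, in_Gp p g /\ Rabs (mtrace g) > 2 /\ fixes g x.

Definition hecke_conjugate (p : nat) (x x' : R) : Prop :=
  hyperbolic_fixed_point p x /\ x' <> x /\
  forall g, in_Gp p g -> fixes g x -> fixes g x'.

(* g generates the stabilizer of x in G_p = <S,T>/{+-I} *)
Definition stab_generator (p : nat) (x : R) (g : Mat) : Prop :=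
  in_Gp p g /\ fixes g x /\
  forall h, in_Gp p h -> fixes h x ->
    exists k : Z, h = mpowZ g k \/ h = mopp (mpowZ g k).

Definition lam_BQF (p : nat) (A B C : R) : Prop :=
  in_Zlam (lam p) A /\ in_Zlam (lam p) B /\ in_Zlam (lam p) C /\
  B ^ 2 - 4 * A * C > 0.

Definition alphaQ (A B C : R) : R := (- B + sqrt (B ^ 2 - 4 * A * C)) / (2 * A).

Definition hyperbolic_form (p : nat) (A B C : R) : Prop :=
  lam_BQF p A B C /\
  exists (x : R) (g : Mat),
    hyperbolic_fixed_point p x /\ stab_generator p x g /\
    x = (ma g - md g + sqrt ((ma g + md g) ^ 2 - 4)) / (2 * mc g) /\
    A = mc g /\ B = md g - ma g /\ C = - mb g.

Definition Gp_simple_form (p : nat) (A B C : R) : Prop :=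
  hyperbolic_form p A B C /\ A > 0 /\ C < 0.

Definition Gp_simple (p : nat) (x : R) : Prop :=
  exists A B C, Gp_simple_form p A B C /\ x = alphaQ A B C.

Definition cf_digit (l y : R) : Z := (Rfloor (y / l) + 1)%Z.
Fixpoint cf_x (l x : R) (j : nat) : R :=
  match j with
  | O => x
  | S j => let y := cf_x l x j in / (IZR (cf_digit l y) * l - y)
  end.
Definition cf_r (l x : R) (j : nat) : Z := cf_digit l (cf_x l x j).

Definition purely_periodic (l x : R) : Prop :=
  exists k : nat, (k > 0)%nat /\ forall j, cf_r l x (j + k) = cf_r l x j.

Definition exceptional_period (p : nat) (x : R) : Prop :=
  forall j, cf_r (lam p) x j =
    (if Nat.eqb (Nat.modulo j (p - 2)) 0 then 2%Z else 1%Z).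

Definition Gp_reduced (p : nat) (x : R) : Prop :=
  purely_periodic (lam p) x /\ ~ exceptional_period p x.

(* Main.v *)
Require Import Defs.
From Stdlib Require Import Reals ZArith List Lra Lia Classical.
Open Scope R_scope.

(** With [U = S T], the matrices [L d] equal to [U^(d+1) T] up to sign ([0 <= d <= p - 2]) are
    nonnegative and map [[0, oo)] onto the cells of a partition of [[0, oo)]; let [F] be the
    expanding map inverting them branchwise, and [P n x] the product of the first [n] branches
    taken by [x], so that [x = P n x (F^n x)].

    Checking the generators [S] and [T] gives a Serret theorem: if [h] in [G_p] fixes [x > 0], then
    [h P n x = +- P m x] and [F^m x = F^n x] for some [m], [n]. So a hyperbolic fixed point is
    eventually [F]-periodic; if moreover its conjugate is negative, it is purely periodic, because
    [F] extends to an injective map of the pairs (point, negative conjugate). Conversely the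
    stabilizer of a purely [F]-periodic [x > 0] is generated by [P k x], [k] the least period, a
    positive matrix. Hence the simple numbers are the positive purely [F]-periodic points.

    A block of steps of the lambda-continued fraction from one point of [[lambda, oo)] to the next,
    conjugated by [S], is a block of steps of [F]. Thus [y + lambda] has periodic complete quotients
    iff [y >= 0] is [F]-periodic with the last branch other than [S], which for the conjugate means
    [-lambda < y' < 0]; this gives the choice of [n] and the range of [i]. Periodic digits force
    periodic complete quotients because the matrix of a period contracts [[0, oo)], and the
    excluded period is the one of the parabolic point [y = 0]. *)

(** * Matrices and their projective action *)

Lemma mat_ext (g h : Mat) :
  ma g = ma h -> mb g = mb h -> mc g = mc h -> md g = md h -> g = h.
Proof. destruct g, h; simpl; intros; subst; reflexivity. Qed.

Ltac mring := apply mat_ext; simpl; ring.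

Definition mdet (g : Mat) : R := ma g * md g - mb g * mc g.

Lemma mmul_assoc g h k : mmul g (mmul h k) = mmul (mmul g h) k.
Proof. mring. Qed.

Lemma mmul_1l g : mmul mid g = g.
Proof. mring. Qed.

Lemma mmul_1r g : mmul g mid = g.
Proof. mring. Qed.

Lemma mmul_oppl g h : mmul (mopp g) h = mopp (mmul g h).
Proof. mring. Qed.

Lemma mmul_oppr g h : mmul g (mopp h) = mopp (mmul g h).
Proof. mring. Qed.

Lemma moppK g : mopp (mopp g) = g.
Proof. mring. Qed.

Lemma minv_mul g h : minv (mmul g h) = mmul (minv h) (minv g).
Proof. mring. Qed.

Lemma mdet_mul g h : mdet (mmul g h) = mdet g * mdet h.
Proof. unfold mdet; simpl; ring. Qed.

Lemma mmulV g : mdet g = 1 -> mmul g (minv g) = mid.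
Proof. unfold mdet; intros H; apply mat_ext; simpl; nra. Qed.

Lemma mmulVl g : mdet g = 1 -> mmul (minv g) g = mid.
Proof. unfold mdet; intros H; apply mat_ext; simpl; nra. Qed.

Lemma mmul_cancel_r g h k : mdet k = 1 -> mmul g k = mmul h k -> g = h.
Proof.
  intros Hk E.
  rewrite <- (mmul_1r g), <- (mmul_1r h), <- (mmulV k Hk), !mmul_assoc, E.
  reflexivity.
Qed.

Lemma mmul_cancel_l g h k : mdet k = 1 -> mmul k g = mmul k h -> g = h.
Proof.
  intros Hk E.
  rewrite <- (mmul_1l g), <- (mmul_1l h), <- (mmulVl k Hk), <- !mmul_assoc, E.
  reflexivity.
Qed.

Lemma mpow_add g m n : mpow g (m + n) = mmul (mpow g m) (mpow g n).
Proof.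
  induction m as [|m IH]; simpl.
  - now rewrite mmul_1l.
  - now rewrite IH, mmul_assoc.
Qed.

Lemma minv_mpow g n : minv (mpow g n) = mpow (minv g) n.
Proof.
  induction n as [|n IH].
  - simpl; mring.
  - replace (S n) with (n + 1)%nat at 1 by lia.
    rewrite mpow_add, minv_mul, IH; simpl; now rewrite mmul_1r.
Qed.

(** The projective action as a relation with denominators cleared: a point sent to infinity is
    related to nothing, and composition becomes polynomial algebra. *)
Definition maps (g : Mat) (x y : R) : Prop :=
  mc g * x + md g <> 0 /\ ma g * x + mb g = y * (mc g * x + md g).

Lemma fixes_maps g x : fixes g x <-> maps g x x.
Proof.
  unfold fixes, maps; split; intros [H1 H2]; split; auto.
  - rewrite <- H2 at 2; field; auto.
  - rewrite H2; field; auto.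
Qed.

Lemma maps_id x : maps mid x x.
Proof. split; simpl; lra. Qed.

Lemma maps_mul g h x y z : maps h x y -> maps g y z -> maps (mmul g h) x z.
Proof.
  intros [H1 H2] [H3 H4]; unfold maps in *; simpl.
  assert (E1 : (mc g * ma h + md g * mc h) * x + (mc g * mb h + md g * md h)
     = (mc g * y + md g) * (mc h * x + md h)).
  { replace ((mc g * ma h + md g * mc h) * x + (mc g * mb h + md g * md h))
      with (mc g * (ma h * x + mb h) + md g * (mc h * x + md h)) by ring.
    rewrite H2; ring. }
  split.
  - rewrite E1; now apply Rmult_integral_contrapositive_currified.
  - rewrite E1.
    replace ((ma g * ma h + mb g * mc h) * x + (ma g * mb h + mb g * md h))
      with (ma g * (ma h * x + mb h) + mb g * (mc h * x + md h)) by ring.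
    rewrite H2.
    transitivity ((ma g * y + mb g) * (mc h * x + md h)); [ring | rewrite H4; ring].
Qed.

Lemma maps_opp g x y : maps g x y -> maps (mopp g) x y.
Proof. intros [H1 H2]; unfold maps; simpl; split; nra. Qed.

Lemma maps_fun g x y z : maps g x y -> maps g x z -> y = z.
Proof.
  intros [H1 H2] [_ H3]; rewrite H2 in H3; now apply Rmult_eq_reg_r in H3.
Qed.

Lemma maps_inv g x y : mdet g = 1 -> maps g x y -> maps (minv g) y x.
Proof.
  unfold mdet; intros D [H1 H2]; unfold maps; simpl.
  (* The denominators of [g] at [x] and of its inverse at [y] are reciprocal, because the
     determinant is 1. *)
  assert (E : (- mc g * y + ma g) * (mc g * x + md g) = 1).
  { replace ((- mc g * y + ma g) * (mc g * x + md g))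
      with (ma g * (mc g * x + md g) - mc g * (y * (mc g * x + md g))) by ring.
    rewrite <- H2, <- D; ring. }
  split; [intros Z; rewrite Z in E; lra |].
  apply (Rmult_eq_reg_r (mc g * x + md g)); [| exact H1].
  rewrite Rmult_assoc, E.
  replace ((md g * y + - mb g) * (mc g * x + md g))
    with (md g * (y * (mc g * x + md g)) - mb g * (mc g * x + md g)) by ring.
  rewrite <- H2.
  replace (md g * (ma g * x + mb g) - mb g * (mc g * x + md g))
    with ((ma g * md g - mb g * mc g) * x) by ring.
  rewrite D; ring.
Qed.

Lemma maps_inj g x y z : mdet g = 1 -> maps g x z -> maps g y z -> x = y.
Proof.
  intros D H1 H2; exact (maps_fun _ _ _ _ (maps_inv _ _ _ D H1) (maps_inv _ _ _ D H2)).
Qed.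

(** Equality as projective transformations, where [g] and [-g] are identified. *)
Definition eqpm (g h : Mat) : Prop := g = h \/ g = mopp h.

Lemma eqpm_sym g h : eqpm g h -> eqpm h g.
Proof. intros [->| ->]; [left | right]; auto; now rewrite moppK. Qed.

Lemma eqpm_trans g h k : eqpm g h -> eqpm h k -> eqpm g k.
Proof.
  intros [->| ->] [->| ->]; unfold eqpm; rewrite ?moppK; auto.
Qed.

Lemma eqpm_mul_r g h k : eqpm g h -> eqpm (mmul g k) (mmul h k).
Proof. intros [->| ->]; unfold eqpm; rewrite ?mmul_oppl; auto. Qed.

Lemma eqpm_mul_l g h k : eqpm g h -> eqpm (mmul k g) (mmul k h).
Proof. intros [->| ->]; unfold eqpm; rewrite ?mmul_oppr; auto. Qed.

Lemma maps_eqpm g h x y : eqpm g h -> maps h x y -> maps g x y.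
Proof. intros [->| ->]; auto using maps_opp. Qed.

Lemma eqpm_cancel_r g h k :
  mdet k = 1 -> eqpm (mmul g k) (mmul h k) -> eqpm g h.
Proof.
  intros D [E|E]; [left | right].
  - now apply mmul_cancel_r in E.
  - rewrite <- mmul_oppl in E; now apply mmul_cancel_r in E.
Qed.

(** * The ring [Z[l]] *)

Definition evl (l : R) (cs : list Z) : R :=
  fold_right (fun c acc => IZR c + l * acc) 0 cs.

Lemma in_Zlam_shift l c x : in_Zlam l x -> in_Zlam l (IZR c + l * x).
Proof. intros [cs ->]; now exists (c :: cs)%list. Qed.

Lemma in_Zlam_0 l : in_Zlam l 0.
Proof. now exists nil. Qed.

Lemma in_Zlam_1 l : in_Zlam l 1.
Proof. exists (1%Z :: nil)%list; simpl; ring. Qed.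

Lemma in_Zlam_gen l : in_Zlam l l.
Proof. exists (0%Z :: 1%Z :: nil)%list; simpl; ring. Qed.

Lemma in_Zlam_add l x y : in_Zlam l x -> in_Zlam l y -> in_Zlam l (x + y).
Proof.
  intros [cs ->]; revert y; induction cs as [|c cs IH]; intros y Hy; simpl.
  - now rewrite Rplus_0_l.
  - destruct Hy as [[|e es] ->]; simpl.
    + rewrite Rplus_0_r; apply in_Zlam_shift; now exists cs.
    + fold (evl l cs) (evl l es).
      replace (IZR c + l * evl l cs + (IZR e + l * evl l es))
        with (IZR (c + e) + l * (evl l cs + evl l es)) by (rewrite plus_IZR; ring).
      apply in_Zlam_shift, IH; now exists es.
Qed.

Lemma in_Zlam_scal l k x : in_Zlam l x -> in_Zlam l (IZR k * x).
Proof.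
  intros [cs ->]; induction cs as [|c cs IH]; simpl.
  - rewrite Rmult_0_r; apply in_Zlam_0.
  - fold (evl l cs) in *.
    replace (IZR k * (IZR c + l * evl l cs))
      with (IZR (k * c) + l * (IZR k * evl l cs)) by (rewrite mult_IZR; ring).
    now apply in_Zlam_shift.
Qed.

Lemma in_Zlam_opp l x : in_Zlam l x -> in_Zlam l (- x).
Proof.
  intros H; replace (- x) with (IZR (-1) * x) by ring; now apply in_Zlam_scal.
Qed.

Lemma in_Zlam_mul l x y : in_Zlam l x -> in_Zlam l y -> in_Zlam l (x * y).
Proof.
  intros [cs ->] Hy; induction cs as [|c cs IH]; simpl.
  - rewrite Rmult_0_l; apply in_Zlam_0.
  - fold (evl l cs) in *.
    replace ((IZR c + l * evl l cs) * y)
      with (IZR c * y + (IZR 0 + l * (evl l cs * y))) by ring.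
    apply in_Zlam_add; [now apply in_Zlam_scal | now apply in_Zlam_shift].
Qed.

(** * The floor function *)

Lemma Rfloor_spec x : IZR (Rfloor x) <= x < IZR (Rfloor x) + 1.
Proof.
  unfold Rfloor; rewrite minus_IZR; pose proof (archimed x); lra.
Qed.

Lemma Rfloor_eq x k : IZR k <= x < IZR k + 1 -> Rfloor x = k.
Proof.
  intros H; pose proof (Rfloor_spec x) as G.
  assert (IZR (Rfloor x) < IZR (k + 1)) by (rewrite plus_IZR; lra).
  assert (IZR k < IZR (Rfloor x + 1)) by (rewrite plus_IZR; lra).
  apply lt_IZR in H0, H1; lia.
Qed.

Section Hecke.

Context (p : nat) (hp : (3 <= p)%nat).
Local Notation l := (lam p).

Lemma in_Gp_det g : in_Gp p g -> mdet g = 1.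
Proof.
  induction 1; try (unfold mdet; simpl; ring).
  rewrite mdet_mul, IHin_Gp1, IHin_Gp2; ring.
Qed.

Lemma in_Gp_Zlam g : in_Gp p g ->
  in_Zlam l (ma g) /\ in_Zlam l (mb g) /\ in_Zlam l (mc g) /\ in_Zlam l (md g).
Proof.
  assert (H0 := in_Zlam_0 l); assert (H1 := in_Zlam_1 l);
  assert (Hl := in_Zlam_gen l).
  induction 1; simpl; repeat split;
    repeat first [assumption | apply in_Zlam_opp]; try (now destruct IHin_Gp1, IHin_Gp2);
    intuition auto using in_Zlam_add, in_Zlam_mul.
Qed.

(** * The Chebyshev sequence [s n = sin (n pi / p) / sin (pi / p)] *)

Definition s (n : nat) : R := sin (INR n * (PI / INR p)) / sin (PI / INR p).

Lemma angle_pos : 0 < PI / INR p.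
Proof.
  pose proof PI_RGT_0; assert (0 < INR p) by (apply lt_0_INR; lia).
  now apply Rdiv_lt_0_compat.
Qed.

Lemma p_angle : INR p * (PI / INR p) = PI.
Proof. field; apply not_0_INR; lia. Qed.

Lemma angle_le : 3 * (PI / INR p) <= PI.
Proof.
  rewrite <- p_angle at 2; apply Rmult_le_compat_r.
  - apply Rlt_le, angle_pos.
  - replace 3 with (INR 3) by (simpl; ring); now apply le_INR.
Qed.

Lemma sin_angle_pos : 0 < sin (PI / INR p).
Proof. pose proof angle_pos; pose proof angle_le; apply sin_gt_0; lra. Qed.

Lemma s0 : s 0 = 0.
Proof. unfold s; simpl; rewrite Rmult_0_l, sin_0; lra. Qed.

Lemma s1 : s 1 = 1.
Proof.
  unfold s; simpl; rewrite Rmult_1_l; field; pose proof sin_angle_pos; lra.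
Qed.

Lemma s_rec n : s (S (S n)) = l * s (S n) - s n.
Proof.
  unfold s, lam; pose proof sin_angle_pos.
  set (t := PI / INR p) in *.
  replace (INR (S (S n)) * t) with (INR (S n) * t + t)
    by (rewrite (S_INR (S n)); ring).
  replace (INR n * t) with (INR (S n) * t - t) by (rewrite (S_INR n); ring).
  rewrite sin_plus, sin_minus; field; lra.
Qed.

Lemma s2 : s 2 = l.
Proof. rewrite s_rec, s1, s0; ring. Qed.

Lemma s_ge1 n : (1 <= n < p)%nat -> 1 <= s n.
Proof.
  intros Hn; unfold s; pose proof sin_angle_pos as Hs; pose proof angle_pos as Ht.
  pose proof angle_le as H3; pose proof p_angle as Hp.
  set (t := PI / INR p) in *.
  assert (H : sin t <= sin (INR n * t)).
  { assert (L1 : t <= INR n * t).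
    { assert (1 <= INR n) by (replace 1 with (INR 1) by reflexivity; apply le_INR; lia).
      nra. }
    assert (L2 : INR n * t <= PI - t).
    { assert (INR n + 1 <= INR p) by (rewrite <- S_INR; apply le_INR; lia).
      nra. }
    destruct (Rle_dec (INR n * t) (PI / 2)).
    - apply sin_incr_1; lra.
    (* Past the middle, reflect: the supplement lies between [t] and [PI / 2]. *)
    - rewrite <- (sin_PI_x (INR n * t)); apply sin_incr_1; lra. }
  apply (Rmult_le_reg_r (sin t)); [lra|]; field_simplify; lra.
Qed.

Lemma s_p : s p = 0.
Proof. unfold s; rewrite p_angle, sin_PI; lra. Qed.

Lemma s_p1 : s (p - 1) = 1.
Proof.
  unfold s; rewrite minus_INR by lia; simpl (INR 1).
  rewrite Rmult_minus_distr_r, p_angle, Rmult_1_l, sin_PI_x.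
  field; pose proof sin_angle_pos; lra.
Qed.

Lemma s_p2 : s (p - 2) = l.
Proof.
  pose proof (s_rec (p - 2)) as H.
  replace (S (S (p - 2))) with p in H by lia.
  replace (S (p - 2)) with (p - 1)%nat in H by lia.
  rewrite s_p, s_p1 in H; lra.
Qed.

Lemma s_ge0 n : (n <= p)%nat -> 0 <= s n.
Proof.
  intros H; destruct (Nat.eq_dec n 0) as [->|]; [rewrite s0; lra|].
  destruct (Nat.eq_dec n p) as [->|]; [rewrite s_p; lra|].
  pose proof (s_ge1 n ltac:(lia)); lra.
Qed.

Lemma l_ge1 : 1 <= l.
Proof. rewrite <- s2; apply s_ge1; lia. Qed.

(** By the recurrence the left side does not depend on [a]. The identity orders the ratios
    [s (S a) / s a], which are the ends of the cells below, and its case [k = 1] is the determinant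
    of [L]. *)
Lemma s_cross a k : s (S a) * s (a + k) - s (S (a + k)) * s a = s k.
Proof.
  induction a as [|a IH].
  - simpl; rewrite s0, s1; ring.
  - simpl plus; rewrite (s_rec a), (s_rec (a + k)), <- IH; ring.
Qed.

Lemma s_det d : s (S d) * s (S d) - s (S (S d)) * s d = 1.
Proof.
  pose proof (s_cross d 1) as H; rewrite s1 in H.
  now replace (d + 1)%nat with (S d) in H by lia.
Qed.

(** * The Farey-type map of the Hecke group *)

(* [L d] is [U^d S] for [U = S T], i.e. [U^(d+1) T] up to sign; the intervals [L d ([0, oo))],
   [d <= p - 2], partition [[0, oo)]. *)
Definition L (d : nat) : Mat := mkMat (s (S d)) (s (S (S d))) (s d) (s (S d)).

Definition U : Mat := mkMat l (-1) 1 0.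

Lemma L_det d : mdet (L d) = 1.
Proof. unfold mdet; simpl; apply s_det. Qed.

Lemma L0 : L 0 = Smat p.
Proof. apply mat_ext; simpl; rewrite ?s0, ?s1, ?s2; auto. Qed.

Lemma U_L d : mmul U (L d) = L (S d).
Proof.
  apply mat_ext; simpl; rewrite ?(s_rec (S d)), ?(s_rec d); ring.
Qed.

Lemma L_last : L (p - 2) = mkMat 1 0 l 1.
Proof.
  apply mat_ext; simpl; rewrite ?s_p2; auto;
    replace (S (p - 2)) with (p - 1)%nat by lia; try apply s_p1.
  replace (S (p - 1)) with p by lia; apply s_p.
Qed.

Lemma in_Gp_U : in_Gp p U.
Proof.
  replace U with (mmul (Smat p) Tmat) by mring.
  apply Gp_mul; [apply Gp_S | apply Gp_T].
Qed.

Lemma in_Gp_L d : in_Gp p (L d).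
Proof.
  induction d as [|d IH]; [rewrite L0; apply Gp_S|].
  rewrite <- U_L; apply Gp_mul; auto using in_Gp_U.
Qed.

(** The cell [s (d+2) / s (d+1) <= x < s (d+1) / s d] with denominators cleared, so that [d = 0],
    where [s 0 = 0], has no upper bound. For [d = p - 2] the lower end is 0, since [s p = 0]. *)
Definition is_digit (d : nat) (x : R) : Prop :=
  (d <= p - 2)%nat /\ s (S (S d)) <= x * s (S d) /\ x * s d < s (S d).

(** Larger digits lie further left: for [d < e], [s_cross] puts the upper end of cell [e] at or
    below the lower end of cell [d]. *)
Lemma is_digit_le d e x : 0 <= x -> is_digit d x -> is_digit e x -> (e <= d)%nat.
Proof.
  intros Hx (Hd1 & Hd2 & _) (He1 & _ & He3).
  destruct (le_lt_dec e d) as [|Hlt]; auto; exfalso.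
  pose proof (s_cross (S d) (e - S d)) as C.
  replace (S d + (e - S d))%nat with e in C by lia.
  pose proof (s_ge0 (e - S d) ltac:(lia)).
  pose proof (s_ge1 (S d) ltac:(lia)); pose proof (s_ge1 e ltac:(lia)).
  assert (s (S (S d)) * s e <= x * s (S d) * s e) by (apply Rmult_le_compat_r; lra).
  assert (x * s e * s (S d) < s (S e) * s (S d)) by (apply Rmult_lt_compat_r; lra).
  nra.
Qed.

Lemma is_digit_uniq d e x : 0 <= x -> is_digit d x -> is_digit e x -> d = e.
Proof.
  intros; apply Nat.le_antisymm; eauto using is_digit_le.
Qed.

Fixpoint digit_from (x : R) (d fuel : nat) : nat :=
  match fuel with
  | O => d
  | S k => if Rle_dec (s (S (S d))) (x * s (S d)) then d
           else digit_from x (S d) k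
  end.

(** With fuel [p - 2] the search runs out at the last cell, whose lower end 0 needs no test. *)
Definition digit (x : R) : nat := digit_from x 0 (p - 2).

Lemma digit_is_digit x : 0 <= x -> is_digit (digit x) x.
Proof.
  intros Hx; unfold digit.
  assert (G : forall fuel d, (d + fuel = p - 2)%nat -> x * s d < s (S d) ->
    is_digit (digit_from x d fuel) x).
  { induction fuel as [|k IH]; intros d Hd Hlt; simpl.
    - split; [lia | split; auto].
      replace (S (S d)) with p by lia; rewrite s_p.
      apply Rmult_le_pos; auto; apply s_ge0; lia.
    - destruct (Rle_dec _ _) as [H|H].
      + split; [lia | split; auto].
      + apply IH; [lia | lra]. }
  apply G; [lia|]; rewrite s0, s1; lra.
Qed.

Definition F (x : R) : R :=
  (s (S (digit x)) * x - s (S (S (digit x)))) /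
  (s (S (digit x)) - s (digit x) * x).

Lemma F_spec x : 0 <= x ->
  (digit x <= p - 2)%nat /\ 0 <= F x /\ maps (L (digit x)) (F x) x.
Proof.
  intros Hx; destruct (digit_is_digit x Hx) as (H1 & H2 & H3).
  unfold F; set (d := digit x) in *.
  pose proof (s_det d) as D.
  assert (P : 0 < s (S d) - s d * x) by lra.
  split; [auto | split].
  - apply Rmult_le_pos; [lra|]; apply Rlt_le, Rinv_0_lt_compat; lra.
  - set (q := s (S d) - s d * x) in *.
    assert (E : s d * ((s (S d) * x - s (S (S d))) / q) + s (S d) = / q).
    { apply (Rmult_eq_reg_r q); [|lra]; field_simplify; [|lra|lra].
      unfold q; nra. }
    unfold maps; simpl; rewrite E; split.
    + apply Rinv_neq_0_compat; lra.
    + apply (Rmult_eq_reg_r q); [|lra]; field_simplify; [|lra|lra].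
      unfold q; nra.
Qed.

Lemma F_ge0 x : 0 <= x -> 0 <= F x.
Proof. intros H; apply (F_spec x H). Qed.

(** [L d] carries the half-line into cell [d] and the cells are disjoint, so a nonnegative preimage
    determines both the digit and [F]. This is how [F] is computed below. *)
Lemma F_intro d x y : (d <= p - 2)%nat -> 0 <= y -> maps (L d) y x ->
  0 <= x /\ digit x = d /\ F x = y.
Proof.
  intros Hd Hy HM; pose proof HM as [H1 H2]; simpl in H1, H2.
  pose proof (s_det d) as D.
  pose proof (s_ge1 (S d) ltac:(lia)) as S1.
  pose proof (s_ge0 d ltac:(lia)) as S0.
  pose proof (s_ge0 (S (S d)) ltac:(lia)) as S2.
  set (q := s d * y + s (S d)) in *.
  assert (Hq : 1 <= q) by (unfold q; nra).
  assert (Hx : 0 <= x).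
  { apply (Rmult_le_reg_r q); [lra|]; rewrite <- H2; nra. }
  assert (Hdig : is_digit d x).
  { split; [auto | split].
    - apply (Rmult_le_reg_r q); [lra|].
      replace (x * s (S d) * q) with (s (S d) * (x * q)) by ring.
      rewrite <- H2; unfold q; nra.
    - apply (Rmult_lt_reg_r q); [lra|].
      replace (x * s d * q) with (s d * (x * q)) by ring.
      rewrite <- H2; unfold q; nra. }
  assert (E : digit x = d) by (eapply is_digit_uniq; eauto using digit_is_digit).
  repeat split; auto.
  destruct (F_spec x Hx) as (_ & _ & HF); rewrite E in HF.
  exact (maps_inj _ _ _ _ (L_det d) HF HM).
Qed.

Lemma digit_0 x : 0 <= x -> (digit x = 0%nat <-> l <= x).
Proof.
  intros Hx; split; intros H.
  - destruct (digit_is_digit x Hx) as (_ & H2 & _).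
    rewrite H, s1, s2 in H2; lra.
  - apply (is_digit_uniq _ _ x); auto using digit_is_digit.
    repeat split; [lia | rewrite s1, s2; lra | rewrite s0, s1; lra].
Qed.

Lemma F_sub x : l <= x -> F x = x - l.
Proof.
  intros H; pose proof l_ge1; apply (F_intro 0); [lia | lra|].
  rewrite L0; split; simpl; lra.
Qed.

Fixpoint P (n : nat) (x : R) : Mat :=
  match n with O => mid | S n => mmul (L (digit x)) (P n (F x)) end.

Definition Fn (n : nat) (x : R) : R := Nat.iter n F x.

Lemma FnS n x : Fn (S n) x = Fn n (F x).
Proof. unfold Fn; now rewrite Nat.iter_succ_r. Qed.

Lemma FnSr n x : Fn (S n) x = F (Fn n x).
Proof. reflexivity. Qed.

Lemma Fn_add m n x : Fn (m + n) x = Fn n (Fn m x).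
Proof.
  revert x; induction m as [|m IH]; intros x; auto.
  change (S m + n)%nat with (S (m + n)); now rewrite !FnS, IH.
Qed.

Lemma Fn_ge0 n x : 0 <= x -> 0 <= Fn n x.
Proof. intros H; induction n; auto; simpl; now apply F_ge0. Qed.

Lemma P_add m n x : P (m + n) x = mmul (P m x) (P n (Fn m x)).
Proof.
  revert x; induction m as [|m IH]; intros x.
  - simpl; now rewrite mmul_1l.
  - change (S m + n)%nat with (S (m + n)).
    rewrite FnS; simpl P; now rewrite IH, mmul_assoc.
Qed.

Lemma P_det n x : mdet (P n x) = 1.
Proof.
  revert x; induction n as [|n IH]; intros x; simpl.
  - unfold mdet; simpl; ring.
  - rewrite mdet_mul, L_det, IH; ring.
Qed.

Lemma in_Gp_P n x : in_Gp p (P n x).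
Proof.
  revert x; induction n as [|n IH]; intros x; simpl.
  - apply Gp_id.
  - apply Gp_mul; auto using in_Gp_L.
Qed.

Lemma P_maps n x : 0 <= x -> maps (P n x) (Fn n x) x.
Proof.
  revert x; induction n as [|n IH]; intros x Hx.
  - apply maps_id.
  - rewrite FnS; simpl P; apply maps_mul with (F x).
    + apply IH; now apply F_ge0.
    + apply (F_spec x Hx).
Qed.

(** * Serret's theorem: equivalent points have a common tail *)

(** A certificate that [k] sends [x] to [y]: after [n] and [m] steps the expansions have the same
    tail, and [k] carries one prefix to the other up to sign. Keeping the matrices, and not only the
    tails, is what later describes the stabilizer. *)
Definition tails (x : R) (k : Mat) (y : R) : Prop :=
  0 <= y /\ exists m n, Fn m y = Fn n x /\ eqpm (mmul k (P n x)) (P m y).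

Lemma tails_maps x k y : 0 <= x -> tails x k y -> maps k x y.
Proof.
  intros Hx (Hy & m & n & E & H).
  assert (M : maps (mmul k (P n x)) (Fn n x) y).
  { apply maps_eqpm with (P m y); auto; rewrite <- E; now apply P_maps. }
  apply maps_eqpm with (mmul (mmul k (P n x)) (minv (P n x))).
  - left; now rewrite <- mmul_assoc, mmulV, mmul_1r by apply P_det.
  - apply maps_mul with (Fn n x); auto.
    apply maps_inv; [apply P_det | now apply P_maps].
Qed.

Lemma tails_eqpm x k k' y : eqpm k' k -> tails x k y -> tails x k' y.
Proof.
  intros HE (Hy & m & n & E & H); split; auto; exists m, n; split; auto.
  eapply eqpm_trans; [apply eqpm_mul_r, HE | auto].
Qed.

(** The two certificates cut the expansion of [y] after [m] and [n'] steps; the shorter cut is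
    prolonged to the longer one. *)
Lemma tails_trans x k y k' z :
  tails x k y -> tails y k' z -> tails x (mmul k' k) z.
Proof.
  intros (Hy & m & n & E & H) (Hz & m' & n' & E' & H'); split; auto.
  destruct (le_lt_dec n' m) as [Hle|Hlt].
  - exists (m' + (m - n'))%nat, n; split.
    + rewrite Fn_add, E', <- Fn_add; replace (n' + (m - n'))%nat with m by lia; auto.
    + rewrite P_add, <- mmul_assoc.
      apply eqpm_trans with (mmul k' (P m y)); [now apply eqpm_mul_l|].
      replace m with (n' + (m - n'))%nat at 1 by lia.
      rewrite P_add, mmul_assoc, E'; now apply eqpm_mul_r.
  - exists m', (n + (n' - m))%nat; split.
    + rewrite Fn_add, <- E, <- Fn_add; replace (m + (n' - m))%nat with n' by lia; auto.
    + rewrite P_add, <- mmul_assoc.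
      apply eqpm_trans with (mmul k' (P n' y)); auto.
      replace n' with (m + (n' - m))%nat at 2 by lia.
      rewrite P_add, E; apply eqpm_mul_l; rewrite mmul_assoc; now apply eqpm_mul_r.
Qed.

Lemma tails_L d y : (d <= p - 2)%nat -> 0 <= y -> forall x, maps (L d) y x ->
  tails y (L d) x /\ tails x (minv (L d)) y.
Proof.
  intros Hd Hy x Hx; destruct (F_intro d x y Hd Hy Hx) as (X & D & E).
  split; split; auto.
  - exists 1%nat, 0%nat; split; [exact E|]; left; simpl; now rewrite D, !mmul_1r.
  - exists 0%nat, 1%nat; split; [symmetry; exact E|]; left; simpl.
    now rewrite D, mmul_1r, mmulVl by apply L_det.
Qed.

Lemma maps_S x : maps (Smat p) x (x + l).
Proof. split; simpl; lra. Qed.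

Lemma maps_U x : x <> 0 -> maps U x (l - / x).
Proof. intros H; split; simpl; [lra | field; lra]. Qed.

(** From [1 / l] on the digit is not the last one, so [U] raises it by one and keeps the tail. *)
Lemma tails_U y : / l <= y -> tails y U (l - / y).
Proof.
  intros H; pose proof l_ge1 as Hl.
  assert (Hy : 0 < y) by (apply Rlt_le_trans with (/ l); auto; apply Rinv_0_lt_compat; lra).
  assert (Hd : (S (digit y) <= p - 2)%nat).
  { destruct (F_spec y ltac:(lra)) as (D1 & D2 & D3).
    destruct (Nat.eq_dec (digit y) (p - 2)) as [E|]; [|lia]; exfalso.
    rewrite E, L_last in D3; destruct D3 as [D3 D4]; simpl in D3, D4.
    assert (1 <= y * l).
    { apply (Rmult_le_reg_r (/ l)); [apply Rinv_0_lt_compat; lra|].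
      rewrite Rmult_1_l, Rmult_assoc, Rinv_r by lra; lra. }
    nra. }
  destruct (F_spec y ltac:(lra)) as (D1 & D2 & D3).
  destruct (F_intro (S (digit y)) (l - / y) (F y) Hd D2) as (X & D & E).
  { rewrite <- U_L; apply maps_mul with y; auto; apply maps_U; lra. }
  split; auto; exists 1%nat, 1%nat; split; [exact E|].
  left; simpl; now rewrite D, !mmul_1r, U_L.
Qed.

(** Up to sign the matrix is the inverse of [U]; below [l] the digit is nonzero and gets lowered by
    one. *)
Lemma tails_TS y : 0 <= y -> y < l -> tails y (mmul Tmat (minv (Smat p))) (/ (l - y)).
Proof.
  intros H0 H1; pose proof l_ge1 as Hl.
  destruct (F_spec y H0) as (D1 & D2 & D3).
  assert (Hd : digit y <> 0%nat) by (rewrite digit_0 by lra; lra).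
  destruct (digit y) as [|d] eqn:E; [lia|].
  assert (M : mmul (mmul Tmat (minv (Smat p))) (L (S d)) = mopp (L d)).
  { rewrite <- U_L; mring. }
  destruct (F_intro d (/ (l - y)) (F y) ltac:(lia) D2) as (X & D & E').
  { rewrite <- (moppK (L d)), <- M; apply maps_opp, maps_mul with y; auto.
    split; simpl; [lra | field; lra]. }
  split; auto; exists 1%nat, 1%nat; split; [exact E'|].
  right; simpl; now rewrite D, E, !mmul_1r, M.
Qed.

(* Without a point at infinity: either [h x >= 0], or [T h x >= 0]. *)
Definition reach (h : Mat) : Prop :=
  forall x, 0 <= x -> exists y, tails x h y \/ tails x (mmul Tmat h) y.

Lemma reach_T h : reach h -> reach (mmul Tmat h).
Proof.
  intros H x Hx; destruct (H x Hx) as [y [Y|Y]]; exists y; [right | left]; auto.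
  apply tails_eqpm with h; auto; right; mring.
Qed.

Lemma reach_S h : reach h -> reach (mmul (Smat p) h).
Proof.
  intros H x Hx; destruct (H x Hx) as [y [Y|Y]]; pose proof l_ge1 as Hl.
  - exists (y + l); left; eapply tails_trans; eauto.
    rewrite <- L0; apply tails_L; [lia | apply Y | rewrite L0; apply maps_S].
  - destruct (Rle_dec (/ l) y) as [Hy|Hy].
    + exists (l - / y); left.
      apply tails_eqpm with (mmul U (mmul Tmat h)); [right; mring|].
      eapply tails_trans; eauto using tails_U.
    + exists (y / (1 - l * y)); right.
      assert (Hq : 0 < 1 - l * y).
      { assert (l * y < l * / l) by (apply Rmult_lt_compat_l; lra).
        rewrite Rinv_r in H0 by lra; lra. }
      apply tails_eqpm with (mmul (minv (L (p - 2))) (mmul Tmat h)).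
      { left; rewrite L_last; mring. }
      eapply tails_trans; eauto.
      apply tails_L; [lia| |].
      * destruct Y as [Y _]; apply Rmult_le_pos; auto.
        apply Rlt_le, Rinv_0_lt_compat; lra.
      * rewrite L_last; unfold maps; simpl.
        assert (E : l * (y / (1 - l * y)) + 1 = / (1 - l * y)) by (field; lra).
        rewrite E; split; [apply Rinv_neq_0_compat; lra | field; lra].
Qed.

Lemma reach_Sinv h : reach h -> reach (mmul (minv (Smat p)) h).
Proof.
  intros H x Hx; destruct (H x Hx) as [y [Y|Y]]; pose proof l_ge1 as Hl.
  - destruct (Rle_dec l y) as [Hy|Hy].
    + exists (y - l); left; eapply tails_trans; eauto.
      rewrite <- L0; apply tails_L; [lia | lra|].
      rewrite L0; split; simpl; lra.
    + exists (/ (l - y)); right; rewrite mmul_assoc.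
      eapply tails_trans; eauto; apply tails_TS; [apply Y | lra].
  - exists (y / (l * y + 1)); right.
    assert (Hy : 0 <= y) by apply Y.
    apply tails_eqpm with (mmul (L (p - 2)) (mmul Tmat h)).
    { left; rewrite L_last; mring. }
    eapply tails_trans; eauto.
    apply tails_L; [lia | auto|].
    rewrite L_last; split; simpl; [nra | field; nra].
Qed.

Lemma reach_Gp g : in_Gp p g -> reach g.
Proof.
  intros H; rewrite <- (mmul_1r g).
  (* Stated for an arbitrary right factor, so that the product case of the induction is
     composition. *)
  assert (G : forall h, reach h -> reach (mmul g h)).
  { induction H; intros k Hk.
    - now rewrite mmul_1l.
    - now apply reach_S.
    - now apply reach_Sinv.
    - now apply reach_T.
    - intros x Hx; destruct (reach_T _ Hk x Hx) as [y Y]; exists y.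
      destruct Y as [Y|Y]; [left | right];
        (eapply tails_eqpm; [|exact Y]); right; mring.
    - rewrite <- mmul_assoc; auto. }
  apply G; intros x Hx; exists x; left; split; auto.
  exists 0%nat, 0%nat; split; auto; left; apply mmul_1l.
Qed.

Lemma stabilizer_tails h x : in_Gp p h -> 0 < x -> maps h x x ->
  exists m n, Fn m x = Fn n x /\ eqpm (mmul h (P n x)) (P m x).
Proof.
  intros Hh Hx Hf; destruct (reach_Gp h Hh x ltac:(lra)) as [y [Y|Y]].
  - assert (y = x) as ->
      by (eapply maps_fun; [apply tails_maps with (2 := Y); lra | auto]).
    apply Y.
  (* The other alternative would make [T h x = T x = -1/x] nonnegative. *)
  - exfalso; pose proof (tails_maps _ _ _ (Rlt_le _ _ Hx) Y) as M.
    assert (M2 : maps (mmul Tmat h) x (- / x)).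
    { apply maps_mul with x; auto; split; simpl; [lra | field; lra]. }
    pose proof (maps_fun _ _ _ _ M M2); destruct Y as [Y _].
    pose proof (Rinv_0_lt_compat x Hx); lra.
Qed.

(** * Pairs of conjugate points *)

(** The inverse branch with a prescribed digit: the conjugate follows the digit of the positive
    point. *)
Definition Lpre (d : nat) (y : R) : R :=
  (s (S d) * y - s (S (S d))) / (s (S d) - s d * y).

Lemma Lpre_neg d y : (d <= p - 2)%nat -> y < 0 ->
  Lpre d y < 0 /\ maps (L d) (Lpre d y) y /\ is_digit d (- Lpre d y).
Proof.
  intros Hd Hy; unfold Lpre.
  pose proof (s_det d) as D.
  pose proof (s_ge1 (S d) ltac:(lia)) as S1.
  pose proof (s_ge0 d ltac:(lia)) as S0.
  pose proof (s_ge0 (S (S d)) ltac:(lia)) as S2.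
  set (q := s (S d) - s d * y).
  assert (Hq : 0 < q) by (unfold q; nra).
  pose proof (Rinv_0_lt_compat q Hq) as Hi.
  set (w := (s (S d) * y - s (S (S d))) / q).
  assert (E1 : s d * w + s (S d) = / q).
  { apply (Rmult_eq_reg_r q); [|lra]; unfold w; field_simplify; [|lra|lra].
    unfold q; nra. }
  assert (E2 : s (S d) * w + s (S (S d)) = y * / q).
  { apply (Rmult_eq_reg_r q); [|lra]; unfold w; field_simplify; [|lra|lra].
    unfold q; nra. }
  assert (y * / q < 0) by nra.
  repeat split; simpl; auto; try nra.
Qed.

(** The natural extension of [F]. *)
Definition Fpair (a : R * R) : R * R := (F (fst a), Lpre (digit (fst a)) (snd a)).

Definition separated (a : R * R) : Prop := 0 <= fst a /\ snd a < 0.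

Lemma Fpair_separated a : separated a -> separated (Fpair a).
Proof.
  intros [H1 H2]; split; simpl; [now apply F_ge0|].
  apply Lpre_neg; auto; now apply F_spec.
Qed.

(* The second coordinate of the image remembers the digit that was removed. *)
Lemma Fpair_inj a b : separated a -> separated b -> Fpair a = Fpair b -> a = b.
Proof.
  destruct a as [x x'], b as [y y']; intros [X X'] [Y Y'] E; simpl in *.
  injection E as E1 E2.
  destruct (F_spec x X) as (X1 & X2 & X3), (F_spec y Y) as (Y1 & Y2 & Y3).
  destruct (Lpre_neg _ _ X1 X') as (X4 & X5 & X6).
  destruct (Lpre_neg _ _ Y1 Y') as (Y4 & Y5 & Y6).
  rewrite <- E2 in Y5, Y6.
  assert (D : digit x = digit y)
    by (eapply is_digit_uniq with (2 := X6) (3 := Y6); lra).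
  rewrite <- D in Y5, Y3; rewrite <- E1 in Y3; f_equal; eauto using maps_fun.
Qed.

Definition Fpn (n : nat) (a : R * R) : R * R := Nat.iter n Fpair a.

Lemma FpnS n a : Fpn (S n) a = Fpn n (Fpair a).
Proof. unfold Fpn; now rewrite Nat.iter_succ_r. Qed.

Lemma Fpn_separated n a : separated a -> separated (Fpn n a).
Proof. intros H; induction n; simpl; auto using Fpair_separated. Qed.

Lemma Fpn_fst n a : fst (Fpn n a) = Fn n (fst a).
Proof. induction n as [|n IH]; simpl; auto; unfold Fn in *; simpl; now rewrite IH. Qed.

Lemma Fpn_snd n a : separated a -> maps (P n (fst a)) (snd (Fpn n a)) (snd a).
Proof.
  revert a; induction n as [|n IH]; intros a Ha.
  - apply maps_id.
  - rewrite FpnS; simpl P; apply maps_mul with (snd (Fpair a)).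
    + exact (IH _ (Fpair_separated a Ha)).
    + apply Lpre_neg; [apply F_spec|]; apply Ha.
Qed.

Lemma Fpn_cancel n q a : separated a -> Fpn (n + q) a = Fpn n a -> Fpn q a = a.
Proof.
  intros Ha; induction n as [|n IH]; simpl; auto; intros E.
  apply IH, Fpair_inj; auto using Fpn_separated.
Qed.

(** The Serret theorem makes the orbit of [z] meet itself at [m] and [n], and its matrix relation
    gives the same for the conjugate. Injectivity on pairs removes the pre-period; [m = n] would
    make [h] plus or minus the identity, against [mc h <> 0]. *)
Lemma hyperbolic_pair_periodic h z z' : in_Gp p h -> mc h <> 0 ->
  0 < z -> z' < 0 -> maps h z z -> maps h z' z' ->
  exists q, (1 <= q)%nat /\ Fpn q (z, z') = (z, z').
Proof.
  intros Hh Hc Hz Hz' M M'.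
  destruct (stabilizer_tails h z Hh Hz M) as (m & n & E & Q).
  set (a := (z, z')).
  assert (Ha : separated a) by (split; simpl; lra).
  assert (EQ : Fpn m a = Fpn n a).
  { rewrite (surjective_pairing (Fpn m a)), (surjective_pairing (Fpn n a)).
    f_equal; [rewrite !Fpn_fst; exact E|].
    apply maps_inj with (P m z) z'; [apply P_det | apply (Fpn_snd m a Ha)|].
    apply maps_eqpm with (mmul h (P n z)); [now apply eqpm_sym|].
    apply maps_mul with z'; auto; apply (Fpn_snd n a Ha). }
  assert (m <> n).
  { intros ->; rewrite <- (mmul_1l (P n z)) in Q at 2.
    apply eqpm_cancel_r in Q; [|apply P_det].
    destruct Q as [->| ->]; simpl in Hc; lra. }
  destruct (le_lt_dec m n).
  - exists (n - m)%nat; split; [lia|]; apply (Fpn_cancel m); auto.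
    now replace (m + (n - m))%nat with n by lia.
  - exists (m - n)%nat; split; [lia|]; apply (Fpn_cancel n); auto.
    now replace (n + (m - n))%nat with m by lia.
Qed.

(** * The continued fraction map versus the Farey-type map *)

Definition cf_step (x : R) : R := / (IZR (cf_digit l x) * l - x).

Lemma cf_digit_spec x : (IZR (cf_digit l x) - 1) * l <= x < IZR (cf_digit l x) * l.
Proof.
  pose proof l_ge1; unfold cf_digit; pose proof (Rfloor_spec (x / l)) as H1.
  rewrite plus_IZR; assert (E : x / l * l = x) by (field; lra); split.
  - rewrite <- E at 2; apply Rmult_le_compat_r; lra.
  - rewrite <- E at 1; apply Rmult_lt_compat_r; lra.
Qed.

Lemma cf_digit_eq x k : (IZR k - 1) * l <= x < IZR k * l -> cf_digit l x = k.
Proof.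
  intros H; pose proof l_ge1; unfold cf_digit.
  replace k with ((k - 1) + 1)%Z by lia; f_equal; apply Rfloor_eq.
  rewrite minus_IZR.
  assert (E : x / l * l = x) by (field; lra); split.
  - apply (Rmult_le_reg_r l); lra.
  - apply (Rmult_lt_reg_r l); lra.
Qed.

Lemma cf_digit_small x : 0 <= x < l -> cf_digit l x = 1%Z.
Proof. intros H; apply cf_digit_eq; lra. Qed.

Lemma cf_digit_add x : cf_digit l (x + l) = (cf_digit l x + 1)%Z.
Proof.
  apply cf_digit_eq; rewrite plus_IZR; pose proof (cf_digit_spec x); lra.
Qed.

Lemma cf_digit_ge2 x : (2 <= cf_digit l x)%Z <-> l <= x.
Proof.
  pose proof l_ge1; pose proof (cf_digit_spec x); split; intros G.
  - apply IZR_le in G; nra.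
  - apply Znot_gt_le; intros G2; assert (G3 : (cf_digit l x <= 1)%Z) by lia.
    apply IZR_le in G3; nra.
Qed.

Lemma cf_step_add x : cf_step (x + l) = cf_step x.
Proof.
  unfold cf_step; rewrite cf_digit_add, plus_IZR; f_equal; ring.
Qed.

Lemma cf_x_S x j : cf_x l x (S j) = cf_x l (cf_step x) j.
Proof.
  induction j as [|j IH]; [reflexivity|].
  change (cf_x l x (S (S j))) with (cf_step (cf_x l x (S j))); now rewrite IH.
Qed.

Lemma cf_x_add x i j : cf_x l x (i + j) = cf_x l (cf_x l x i) j.
Proof.
  revert x; induction i as [|i IH]; intros x; [reflexivity|].
  change (S i + j)%nat with (S (i + j)); now rewrite !cf_x_S, IH.
Qed.

Lemma cf_x_shift x j : (1 <= j)%nat -> cf_x l (x + l) j = cf_x l x j.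
Proof.
  intros Hj; destruct j as [|j]; [lia|]; now rewrite !cf_x_S, cf_step_add.
Qed.

Lemma cf_x_mul x k : cf_x l x k = x -> forall n, cf_x l x (n * k) = x.
Proof.
  intros E n; induction n as [|n IH]; [reflexivity|].
  change (S n * k)%nat with (k + n * k)%nat; now rewrite cf_x_add, E.
Qed.

(** Encodes one step read backwards, [x = r l - 1 / x_1]. *)
Definition M (r : Z) : Mat := mkMat (IZR r * l) (-1) 1 0.

Fixpoint V (n : nat) (x : R) : Mat :=
  match n with O => mid | S n => mmul (M (cf_digit l x)) (V n (cf_step x)) end.

Lemma V_add m n x : V (m + n) x = mmul (V m x) (V n (cf_x l x m)).
Proof.
  revert x; induction m as [|m IH]; intros x.
  - simpl; now rewrite mmul_1l.
  - change (S m + n)%nat with (S (m + n)).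
    rewrite cf_x_S; simpl V; now rewrite IH, mmul_assoc.
Qed.

Lemma V_maps n x : maps (V n x) (cf_x l x n) x.
Proof.
  revert x; induction n as [|n IH]; intros x; [apply maps_id|].
  rewrite cf_x_S; simpl V; apply maps_mul with (cf_step x); auto.
  pose proof (cf_digit_spec x) as H; unfold maps, cf_step; simpl.
  assert (/ (IZR (cf_digit l x) * l - x) <> 0) by (apply Rinv_neq_0_compat; lra).
  split; [lra | field; lra].
Qed.

Lemma V_ext n x y : (forall j, (j < n)%nat -> cf_r l x j = cf_r l y j) -> V n x = V n y.
Proof.
  revert x y; induction n as [|n IH]; intros x y H; [reflexivity|].
  simpl; f_equal.
  - f_equal; exact (H 0%nat ltac:(lia)).
  - apply IH; intros j Hj; specialize (H (S j) ltac:(lia)).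
    unfold cf_r in *; now rewrite !cf_x_S in H.
Qed.

Lemma V_shift n x : (1 <= n)%nat -> V n (x + l) = mmul (Smat p) (V n x).
Proof.
  intros Hn; destruct n as [|n]; [lia|]; simpl.
  rewrite cf_step_add, cf_digit_add, mmul_assoc; f_equal.
  apply mat_ext; simpl; rewrite ?plus_IZR; ring.
Qed.

(** Below [l] the continued fraction digit is 1 and the step is the inverse of [U], which lowers the
    Farey digit by one without changing [F]. *)
Lemma cf_step_digit y d : 0 <= y -> digit y = S d ->
  y < l /\ 0 <= cf_step y /\ digit (cf_step y) = d /\ F (cf_step y) = F y /\
  M (cf_digit l y) = U.
Proof.
  intros Hy E; pose proof (digit_0 y Hy) as D0; pose proof l_ge1 as Hl.
  assert (Hlt : y < l) by (destruct (Rlt_dec y l); auto; exfalso; rewrite E in D0;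
    assert (S d = 0%nat) by (apply D0; lra); lia).
  assert (Ed : cf_digit l y = 1%Z) by (apply cf_digit_small; lra).
  assert (Es : cf_step y = / (l - y)) by (unfold cf_step; rewrite Ed; f_equal; ring).
  destruct (F_spec y Hy) as (D1 & D2 & D3); rewrite E in D1, D3.
  destruct (F_intro d (cf_step y) (F y) ltac:(lia) D2) as (X1 & X2 & X3).
  { assert (EL : L d = mmul (minv U) (L (S d))) by (rewrite <- U_L; mring).
    rewrite EL; apply maps_mul with y; auto.
    rewrite Es; split; simpl; [lra | field; lra]. }
  repeat split; auto.
  rewrite Ed; unfold M, U; f_equal; ring.
Qed.

(** The Farey digit counts down by one per step until it is 0, where [F] subtracts [l]; hence the
    run ends at [F y + l]. *)
Lemma cf_run d y : 0 <= y -> digit y = S d ->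
  cf_x l y (S d) = F y + l /\ mmul (V (S d) y) (Smat p) = L (S d) /\
  forall j, (j <= d)%nat -> 0 <= cf_x l y j < l.
Proof.
  revert y; induction d as [|d IH]; intros y Hy E;
    destruct (cf_step_digit y _ Hy E) as (H1 & H2 & H3 & H4 & H5).
  - split; [|split].
    + rewrite cf_x_S; simpl; rewrite <- H4, F_sub; [ring | now apply digit_0].
    + simpl; now rewrite mmul_1r, H5, <- L0, U_L.
    + intros j Hj; replace j with 0%nat by lia; simpl; lra.
  - destruct (IH _ H2 H3) as (I1 & I2 & I3); split; [|split].
    + rewrite cf_x_S, I1, H4; auto.
    + remember (S d) as e; simpl; now rewrite <- mmul_assoc, I2, H5, U_L.
    + intros [|j] Hj; [simpl; lra|]; rewrite cf_x_S; apply I3; lia.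
Qed.

Lemma digit_succ y : 0 <= y < l -> exists d, digit y = S d.
Proof.
  intros H; destruct (digit y) as [|d] eqn:E; [|eauto].
  apply digit_0 in E; lra.
Qed.

(** A branch [S] costs no continued fraction step, since the quotients after the first ignore
    translation by [l]. The bound on [Fn q y] makes the last branch different from [S], so a run
    ends there. *)
Lemma cf_of_Farey q y : 0 <= y -> Fn q y < l ->
  exists k, (1 <= k)%nat /\ cf_x l (y + l) k = Fn (S q) y + l.
Proof.
  revert y; induction q as [|q IH]; intros y Hy Hq.
  - destruct (digit_succ y) as [d E]; [split; auto|].
    exists (S d); split; [lia|].
    rewrite cf_x_shift by lia; now apply cf_run.
  - rewrite FnS in Hq |- *.
    destruct (IH (F y) (F_ge0 y Hy) Hq) as (k & Hk & Ek).
    destruct (Rlt_dec y l) as [Hlt|Hge].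
    + destruct (digit_succ y) as [d E]; [lra|].
      destruct (cf_run d y Hy E) as (R1 & _).
      exists (S d + k)%nat; split; [lia|].
      now rewrite cf_x_add, cf_x_shift, R1 by lia.
    + exists k; split; auto.
      rewrite cf_x_shift by auto; rewrite F_sub in Ek at 1 by lra.
      now replace (y - l + l) with y in Ek by ring.
Qed.

(** Quotients strictly inside a run are below [l], so the last hypothesis forces [k] to end a
    run. *)
Lemma Farey_of_cf k y : (1 <= k)%nat -> 0 <= y -> l <= cf_x l (y + l) k ->
  exists q, (1 <= q)%nat /\ Fn q y = cf_x l (y + l) k - l /\
    mmul (V k (y + l)) (Smat p) = mmul (Smat p) (P q y).
Proof.
  revert y; induction k as [k IHk] using (well_founded_induction lt_wf).
  intros y Hk Hy; pose proof l_ge1 as Hl.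
  (* A second induction, on a bound for [y / l]: subtracting [l] is a Farey step but uses up none of
     the [k] steps. *)
  assert (HN : exists N : nat, y < INR N * l).
  { destruct (INR_unbounded (y / l)) as [N HN]; exists N.
    assert (E : y / l * l = y) by (field; lra); rewrite <- E.
    apply Rmult_lt_compat_r; lra. }
  destruct HN as [N HN]; revert y Hy HN.
  induction N as [|N IHN]; intros y Hy HN Hge; [simpl in HN; lra|].
  destruct (Rlt_dec y l) as [Hlt|Hy2].
  - destruct (digit_succ y) as [d E]; [lra|].
    destruct (cf_run d y Hy E) as (R1 & R2 & R3).
    destruct (lt_eq_lt_dec k (S d)) as [[C|C]|C].
    + rewrite cf_x_shift in Hge by auto; specialize (R3 k ltac:(lia)); lra.
    + subst k; exists 1%nat; split; [lia | split].
      * rewrite cf_x_shift, R1 by lia; simpl; ring.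
      * rewrite V_shift, <- mmul_assoc, R2 by lia; simpl.
        now rewrite E, mmul_1r.
    + assert (Ek : k = (S d + (k - S d))%nat) by lia.
      remember (k - S d)%nat as k'.
      rewrite Ek, cf_x_add, cf_x_shift, R1 in Hge by lia.
      destruct (IHk k' ltac:(lia) (F y) ltac:(lia) (F_ge0 y Hy) Hge)
        as (q & Q1 & Q2 & Q3).
      exists (S q); split; [lia | split].
      * rewrite FnS, Q2, Ek, cf_x_add, (cf_x_shift y), R1 by lia; auto.
      * rewrite Ek, V_add, cf_x_shift, R1, <- mmul_assoc, Q3 by lia.
        rewrite V_shift, !mmul_assoc by lia; simpl P; rewrite E.
        rewrite <- R2, !mmul_assoc; auto.
  - destruct (IHN (y - l)) as (q & Q1 & Q2 & Q3); try lra.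
    + rewrite S_INR in HN; lra.
    + replace (y - l + l) with y by ring; rewrite <- cf_x_shift; auto.
    + replace (y - l + l) with y in Q2, Q3 by ring.
      exists (S q); split; [lia | split].
      * rewrite FnS, F_sub, Q2, cf_x_shift by (auto; lra); auto.
      * rewrite V_shift, <- mmul_assoc, Q3 by auto; simpl P.
        rewrite F_sub by lra; replace (digit y) with 0%nat; [now rewrite L0|].
        symmetry; apply digit_0; lra.
Qed.

(** * Purely periodic expansions *)

Definition posmat (g : Mat) : Prop :=
  1 <= ma g /\ 0 <= mb g /\ 0 <= mc g /\ 1 <= md g.

Lemma posmat_L d : (d <= p - 2)%nat -> posmat (L d).
Proof.
  intros H; repeat split; simpl;
    first [apply s_ge1; lia | apply s_ge0; lia].
Qed.

Lemma posmat_mul g h : posmat g -> posmat h ->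
  posmat (mmul g h) /\ mb g + mc g <= mb (mmul g h) + mc (mmul g h).
Proof. unfold posmat; simpl; intros; repeat split; nra. Qed.

Lemma posmat_P n x : 0 <= x -> posmat (P n x).
Proof.
  revert x; induction n as [|n IH]; intros x Hx.
  - repeat split; simpl; lra.
  - simpl; apply posmat_mul; [apply posmat_L; now apply F_spec|].
    apply IH; now apply F_ge0.
Qed.

(** A single branch has off-diagonal sum [s d + s (d+2) = l * s (d+1) > 0], and further factors do
    not decrease it. *)
Lemma P_offdiag n x : 0 <= x -> (1 <= n)%nat -> 0 < mb (P n x) + mc (P n x).
Proof.
  intros Hx Hn; destruct n as [|n]; [lia|]; simpl P.
  destruct (F_spec x Hx) as (D & FX & _).
  destruct (posmat_mul _ _ (posmat_L _ D) (posmat_P n (F x) FX)) as [_ G].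
  apply Rlt_le_trans with (2 := G); simpl.
  pose proof (s_rec (digit x)); pose proof l_ge1.
  pose proof (s_ge1 (S (digit x)) ltac:(lia)); nra.
Qed.

(* A nonnegative matrix with diagonal at least 1 contracts the positive half-line, so the
   gaps of an inverse orbit never shrink. *)
Lemma bounded_backward_orbit g (y : nat -> R) (B : R) :
  posmat g -> mdet g = 1 -> (forall n, 0 <= y n <= B) ->
  (forall n, maps g (y (S n)) (y n)) -> y 1%nat = y 0%nat.
Proof.
  intros (G1 & G2 & G3 & G4) D HB HM.
  assert (Step : forall n, exists c, 1 <= c /\
    y (S (S n)) - y (S n) = c * (y (S n) - y n)).
  { intros n; destruct (HM n) as [_ E1], (HM (S n)) as [_ E2].
    (* The expansion factor is the product of the two denominators, each at least 1, by
       [mdet g = 1]. *)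
    exists ((mc g * y (S (S n)) + md g) * (mc g * y (S n) + md g)).
    pose proof (HB (S n)); pose proof (HB (S (S n))); split; [|unfold mdet in D].
    - assert (1 <= mc g * y (S (S n)) + md g) by nra.
      assert (1 <= mc g * y (S n) + md g) by nra. nra.
    - set (u := y (S n)) in *; set (v := y (S (S n))) in *; set (w := y n) in *.
      transitivity ((u * (mc g * v + md g)) * (mc g * u + md g)
                    - (w * (mc g * u + md g)) * (mc g * v + md g)); [|ring].
      rewrite <- E1, <- E2.
      transitivity ((ma g * md g - mb g * mc g) * (v - u)); [rewrite D|]; ring. }
  set (e := y 1%nat - y 0%nat).
  assert (Gap : forall n, exists c, 1 <= c /\ y (S n) - y n = c * e).
  { induction n as [|n (c & C1 & C2)]; [exists 1; split; [lra | unfold e; ring]|].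
    destruct (Step n) as (c' & C1' & C2'); exists (c' * c); split; [nra|].
    rewrite C2', C2; ring. }
  assert (Sum : forall n, exists c, INR n <= c /\ y n - y 0%nat = c * e).
  { induction n as [|n (c & C1 & C2)]; [exists 0; split; [simpl; lra | ring]|].
    destruct (Gap n) as (c' & C1' & C2'); exists (c + c'); split.
    - rewrite S_INR; lra.
    - replace (y (S n) - y 0%nat) with ((y (S n) - y n) + (y n - y 0%nat)) by ring.
      rewrite C2, C2'; ring. }
  destruct (Req_dec e 0) as [E|E]; [unfold e in E; lra | exfalso].
  destruct (INR_unbounded (B / Rabs e)) as [n Hn].
  destruct (Sum n) as (c & C1 & C2).
  pose proof (Rabs_pos_lt e E) as He.
  assert (B < INR n * Rabs e).
  { replace B with (B / Rabs e * Rabs e) by (field; lra).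
    apply Rmult_lt_compat_r; lra. }
  assert (Rabs (c * e) <= B).
  { rewrite <- C2; pose proof (HB n); pose proof (HB 0%nat).
    unfold Rabs; destruct (Rcase_abs _); lra. }
  pose proof (pos_INR n).
  rewrite Rabs_mult, (Rabs_pos_eq c) in H0 by lra; nra.
Qed.

(** The quotients at multiples of [k] have the same digits, hence lie between [l] and a common bound
    and share the matrix of one period. They form a bounded backward orbit, so the first two
    coincide. *)
Lemma periodic_digits_periodic x k : l <= x -> (1 <= k)%nat ->
  (forall j, cf_r l x (j + k) = cf_r l x j) -> cf_x l x k = x.
Proof.
  intros Hx Hk Hper; pose proof l_ge1 as Hl.
  set (b := fun n => cf_x l x (n * k)).
  assert (Hb : forall n j, cf_r l (b n) j = cf_r l x j).
  { intros n j; unfold cf_r, b; rewrite <- cf_x_add; fold (cf_r l x (n * k + j)).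
    induction n as [|n IH]; [reflexivity|].
    replace (S n * k + j)%nat with (n * k + j + k)%nat by (simpl; lia).
    now rewrite Hper. }
  assert (Hge : forall n, l <= b n).
  { intros n; apply cf_digit_ge2.
    change (cf_digit l (b n)) with (cf_r l (b n) 0); rewrite Hb.
    now apply cf_digit_ge2. }
  assert (Hub : forall n, b n < IZR (cf_digit l x) * l).
  { intros n; change (cf_digit l x) with (cf_r l x 0); rewrite <- (Hb n).
    apply cf_digit_spec. }
  assert (HbS : forall n, b (S n) = cf_x l (b n) k).
  { intros n; unfold b; rewrite <- cf_x_add; f_equal; simpl; lia. }
  set (y := fun n => b n - l).
  assert (HP : forall n, exists q, maps (P q (y n)) (y (S n)) (y n) /\
    mmul (V k x) (Smat p) = mmul (Smat p) (P q (y n))).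
  { intros n; assert (Y : y n + l = b n) by (unfold y; ring).
    assert (Yn : 0 <= y n) by (unfold y; specialize (Hge n); lra).
    destruct (Farey_of_cf k (y n) Hk Yn) as (q & _ & Q2 & Q3).
    { rewrite Y, <- HbS; auto. }
    exists q; split.
    - rewrite Y, <- HbS in Q2; fold (y (S n)) in Q2; rewrite <- Q2.
      now apply P_maps.
    - rewrite <- Q3, Y; f_equal; apply V_ext; auto. }
  destruct (HP 0%nat) as (q0 & _ & E0).
  assert (E : y 1%nat = y 0%nat).
  { apply (bounded_backward_orbit (P q0 (y 0%nat)) y (IZR (cf_digit l x) * l)).
    - apply posmat_P; unfold y; specialize (Hge 0%nat); lra.
    - apply P_det.
    - intros n; unfold y; specialize (Hge n); specialize (Hub n); lra.
    (* The length [q] may depend on [n], but the matrix is always the one determined by [V k x]. *)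
    - intros n; destruct (HP n) as (q & Q1 & Q2).
      rewrite E0 in Q2; apply mmul_cancel_l in Q2; [now rewrite Q2|].
      unfold mdet; simpl; ring. }
  unfold y, b in E; simpl in E; rewrite Nat.add_0_r in E; lra.
Qed.

(** * The parabolic point 0 and the excluded period *)

Lemma digit_zero : digit 0 = S (p - 3) /\ F 0 = 0.
Proof.
  destruct (F_intro (p - 2) 0 0 ltac:(lia) ltac:(lra)) as (_ & H1 & H2).
  - rewrite L_last; split; simpl; lra.
  - split; auto; rewrite H1; lia.
Qed.

Lemma cf_x_l : cf_x l l (p - 2) = l /\
  forall j, (1 <= j < p - 2)%nat -> 0 <= cf_x l l j < l.
Proof.
  destruct digit_zero as [D E].
  destruct (cf_run (p - 3) 0 ltac:(lra) D) as (R1 & _ & R3).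
  replace (S (p - 3)) with (p - 2)%nat in R1 by lia.
  assert (Sh : forall j, (1 <= j)%nat -> cf_x l l j = cf_x l 0 j)
    by (intros j Hj; now rewrite <- (cf_x_shift 0 j), Rplus_0_l).
  split.
  - rewrite Sh, R1, E by lia; ring.
  - intros j Hj; rewrite Sh by lia; apply R3; lia.
Qed.

Lemma exceptional_l : exceptional_period p l.
Proof.
  intros j; destruct cf_x_l as [E1 E2]; pose proof l_ge1.
  assert (Ej : (j = (j / (p - 2)) * (p - 2) + j mod (p - 2))%nat)
    by (rewrite Nat.mul_comm; apply Nat.div_mod; lia).
  pose proof (Nat.mod_upper_bound j (p - 2) ltac:(lia)) as Hlt.
  set (t := (j mod (p - 2))%nat) in *.
  unfold cf_r; rewrite Ej, cf_x_add, (cf_x_mul _ _ E1).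
  destruct (Nat.eqb_spec t 0) as [->|N].
  - simpl; apply cf_digit_eq; lra.
  - apply cf_digit_small, E2; lia.
Qed.

(** Going back over one excluded period is, after translation by [l], the parabolic branch
    [L (p - 2)]: the matrix depends only on the digits and can be computed at [l]. *)
Lemma exceptional_step x : exceptional_period p x ->
  exceptional_period p (cf_x l x (p - 2)) /\ l <= x /\
  maps (L (p - 2)) (cf_x l x (p - 2) - l) (x - l).
Proof.
  intros Hx.
  assert (Hn : exceptional_period p (cf_x l x (p - 2))).
  { intros j; unfold cf_r; rewrite <- cf_x_add; fold (cf_r l x (p - 2 + j)).
    rewrite (Hx (p - 2 + j)%nat).
    replace (p - 2 + j)%nat with (j + 1 * (p - 2))%nat by lia.
    now rewrite Nat.Div0.mod_add. }
  split; [auto | split].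
  - apply cf_digit_ge2; change (cf_digit l x) with (cf_r l x 0).
    rewrite (Hx 0%nat), Nat.Div0.mod_0_l; simpl; lia.
  - destruct digit_zero as [D _].
    destruct (cf_run (p - 3) 0 ltac:(lra) D) as (_ & R2 & _).
    replace (S (p - 3)) with (p - 2)%nat in R2 by lia.
    assert (E : V (p - 2) x = mmul (Smat p) (V (p - 2) 0)).
    { rewrite <- V_shift, Rplus_0_l by lia; apply V_ext; intros j _.
      now rewrite (Hx j), (exceptional_l j). }
    rewrite <- R2.
    replace (mmul (V (p - 2) 0) (Smat p))
      with (mmul (minv (Smat p)) (mmul (V (p - 2) x) (Smat p)))
      by (rewrite E, <- mmul_assoc, mmul_assoc, mmulVl, mmul_1l; auto;
          unfold mdet; simpl; ring).
    apply maps_mul with x; [apply maps_mul with (cf_x l x (p - 2))|].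
    + split; simpl; lra.
    + apply V_maps.
    + split; simpl; lra.
Qed.

(** Quotients [u], [v] one excluded period apart satisfy [v - u = l (v - l) (u - l)], so they
    strictly increase unless they start at [l]. After [k (p - 2)] steps this contradicts the period
    [k]. *)
Lemma exceptional_periodic_eq x k : exceptional_period p x -> (1 <= k)%nat ->
  cf_x l x k = x -> x = l.
Proof.
  intros Hx Hk E; pose proof l_ge1 as Hl.
  assert (G : forall n, exceptional_period p (cf_x l x (n * (p - 2))) /\
    x <= cf_x l x (n * (p - 2)) /\ (l < x -> (1 <= n)%nat -> x < cf_x l x (n * (p - 2)))).
  { induction n as [|n (I1 & I2 & I3)].
    - split; [exact Hx | split; [simpl; lra | intros _ ?; lia]].
    - replace (S n * (p - 2))%nat with (n * (p - 2) + (p - 2))%nat by (simpl; lia).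
      rewrite cf_x_add; set (u := cf_x l x (n * (p - 2))) in *.
      destruct (exceptional_step u I1) as (J1 & J2 & J3).
      destruct (exceptional_step _ J1) as (_ & J4 & _).
      set (v := cf_x l u (p - 2)) in *.
      rewrite L_last in J3; destruct J3 as [J3 J5]; simpl in J3, J5.
      assert (EV : v - u = l * (v - l) * (u - l)) by lra.
      assert (0 <= l * (v - l) * (u - l)) 
        by (apply Rmult_le_pos; [apply Rmult_le_pos|]; lra).
      split; [auto | split; [lra|]]; intros Hlt _.
      assert (0 < l * (v - l) * (u - l))
        by (apply Rmult_lt_0_compat; [apply Rmult_lt_0_compat|]; lra).
      lra. }
  destruct (G k) as (_ & _ & G3), (exceptional_step x Hx) as (_ & J & _).
  rewrite Nat.mul_comm, (cf_x_mul _ _ E) in G3.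
  destruct (Req_dec x l) as [|N]; auto; specialize (G3 ltac:(lra) Hk); lra.
Qed.

(** * Simple and reduced numbers *)

(** The discriminant [(d - a)^2 + 4bc] equals [(a + d)^2 - 4], so [alphaQ] is the fixed point
    itself; the product of the two fixed points is [-b/c], negative because [A > 0 > C]. *)
Lemma simple_elim x : Gp_simple p x -> exists g x',
  in_Gp p g /\ 0 < mc g /\ x' < 0 < x /\ maps g x x /\ maps g x' x'.
Proof.
  intros (A & B & C & [[[_ [_ [_ HD]]] HF] [HA HC]] & ->).
  destruct HF as (x0 & g & _ & (G1 & G2 & _) & Ex & EA & EB & EC).
  assert (D := in_Gp_det g G1); unfold mdet in D.
  assert (Hx0 : alphaQ A B C = x0).
  { rewrite Ex; unfold alphaQ; rewrite EA, EB, EC; f_equal.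
    replace ((md g - ma g) ^ 2 - 4 * mc g * - mb g)
      with ((ma g + md g) ^ 2 - 4) by nra; ring. }
  set (x := alphaQ A B C) in *; clearbody x.
  assert (HM : maps g x x) by (apply fixes_maps; now rewrite Hx0).
  subst A; assert (Hc : 0 < mc g) by lra; assert (Hb : 0 < mb g) by lra.
  destruct HM as [N1 N2].
  assert (Hx : 0 < x).
  { rewrite Hx0, Ex; apply Rdiv_lt_0_compat; [|lra].
    set (r := sqrt _); assert (0 <= r) by apply sqrt_pos.
    assert (r * r = (ma g + md g) ^ 2 - 4).
    { apply sqrt_sqrt; subst B C; simpl in HD |- *; nra. }
    assert (r * r = (md g - ma g) * (md g - ma g) + 4 * (mb g * mc g)) by nra.
    assert (0 < mb g * mc g) by nra.
    nra. }
  set (x' := - (mb g / mc g) / x).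
  assert (Hx' : x' * x * mc g = - mb g) by (unfold x'; field; lra).
  clearbody x'; assert (Hneg : x' < 0).
  { apply Rnot_le_lt; intros Q; assert (0 <= x' * x * mc g)
      by (repeat apply Rmult_le_pos; lra); lra. }
  assert (HV : mc g * (x + x') = ma g - md g).
  { apply (Rmult_eq_reg_r x); [lra | lra]. }
  exists g, x'; repeat split; auto; try lra.
  - (* the values of [c X + d] at the two fixed points have product [det g = 1] *)
    intros Q; assert ((mc g * x + md g) * (mc g * x' + md g) = 1).
    { transitivity (mc g * (x' * x * mc g) + md g * (mc g * (x + x')) + md g * md g);
        [ring | rewrite Hx', HV, <- D; ring]. }
    rewrite Q in H; lra.
  - apply (Rmult_eq_reg_r x); [|lra].
    transitivity (ma g * (x' * x) + mb g * x); [ring|].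
    transitivity (x' * (mc g * (x + x') * x) - mc g * x * x * x' + md g * (x' * x));
      [|ring].
    rewrite HV; nra.
Qed.

Lemma in_Gp_translation k :
  in_Gp p (mkMat 1 (INR k * l) 0 1) /\ in_Gp p (minv (mkMat 1 (INR k * l) 0 1)).
Proof.
  induction k as [|k [I1 I2]].
  - replace (mkMat 1 (INR 0 * l) 0 1) with mid by mring.
    replace (minv mid) with mid by mring; split; apply Gp_id.
  - rewrite S_INR.
    replace (mkMat 1 ((INR k + 1) * l) 0 1)
      with (mmul (Smat p) (mkMat 1 (INR k * l) 0 1)) by mring.
    rewrite minv_mul; split; apply Gp_mul; auto; [apply Gp_S | apply Gp_Sinv].
Qed.

Lemma simple_reduced g x x' : in_Gp p g -> mc g <> 0 -> x' < 0 < x ->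
  maps g x x -> maps g x' x' ->
  Gp_reduced p (x + IZR (- Rfloor (x' / l)) * l).
Proof.
  intros Hg Hc [Hx' Hx] HM HM'; pose proof l_ge1 as Hl.
  pose proof (Rfloor_spec (x' / l)) as Hf.
  set (n := (- Rfloor (x' / l))%Z).
  assert (En : IZR n = - IZR (Rfloor (x' / l))) by (unfold n; apply opp_IZR).
  assert (EX : x' / l * l = x') by (field; lra).
  assert (Hn : (1 <= n)%Z).
  { apply (Zlt_le_succ 0), lt_IZR; rewrite En.
    assert (x' / l < 0) by (apply (Rmult_lt_reg_r l); lra); lra. }
  (* One translation short of the claim: [y] is still positive and its conjugate [y'] lies in
     [[-l, 0)], so the pair is purely periodic. *)
  set (t := (IZR n - 1) * l); set (y := x + t); set (y' := x' + t).
  assert (Ht : 0 <= t).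
  { apply IZR_le in Hn; unfold t; apply Rmult_le_pos; lra. }
  assert (Hy' : - l <= y' < 0).
  { unfold y', t; rewrite <- EX, En.
    set (f := IZR (Rfloor (x' / l))) in *; split.
    - replace (x' / l * l + (- f - 1) * l) with ((x' / l - f) * l - l) by ring.
      assert (0 <= (x' / l - f) * l) by (apply Rmult_le_pos; lra); lra.
    - replace (x' / l * l + (- f - 1) * l) with ((x' / l - f - 1) * l) by ring.
      assert (0 < (f + 1 - x' / l) * l) by (apply Rmult_lt_0_compat; lra); lra. }
  replace (x + IZR n * l) with (y + l) by (unfold y, t; ring).
  set (St := mkMat 1 t 0 1).
  assert (HSt : in_Gp p St /\ in_Gp p (minv St)).
  { unfold St, t; destruct (Z_of_nat_complete (n - 1) ltac:(lia)) as [k Ek].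
    replace (IZR n - 1) with (INR k)
      by (rewrite INR_IZR_INZ, <- Ek, minus_IZR; ring).
    apply in_Gp_translation. }
  destruct HSt as [HSt HStV].
  set (h := mmul (mmul St g) (minv St)).
  assert (Hconj : forall u, maps g u u -> maps h (u + t) (u + t)).
  { intros u Hu; apply maps_mul with u; [|apply maps_mul with u; auto];
      split; simpl; lra. }
  destruct (hyperbolic_pair_periodic h y y') as (q & Hq & Eq); auto.
  - unfold h; repeat apply Gp_mul; auto.
  - unfold h, St; simpl; lra.
  - unfold y; lra.
  - lra.
  - now apply Hconj.
  - now apply Hconj.
  - destruct q as [|q]; [lia|].
    assert (Hy : 0 < y) by (unfold y; lra).
    (* A last branch [S] would give [y' = w - l] with [w < 0], below [-l]. *)
    assert (Hlast : Fn q y < l).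
    { apply Rnot_le_lt; intros Hge.
      assert (Ha : separated (y, y')) by (split; simpl; lra).
      destruct (Fpn_separated q _ Ha) as [_ Hs].
      assert (Hd : digit (fst (Fpn q (y, y'))) = 0%nat)
        by (rewrite Fpn_fst; apply digit_0; auto; apply Fn_ge0; simpl; lra).
      change (Fpn (S q) (y, y')) with (Fpair (Fpn q (y, y'))) in Eq.
      unfold Fpair in Eq; rewrite Hd in Eq; injection Eq as _ Eq.
      unfold Lpre in Eq; rewrite s0, s1, s2 in Eq.
      set (w := snd (Fpn q (y, y'))) in *.
      assert (w - l = y') by (rewrite <- Eq; field); lra. }
    destruct (cf_of_Farey q y ltac:(lra) Hlast) as (k & Hk & Ek).
    replace (Fn (S q) y) with y in Ek
      by (change y with (fst (y, y')) at 2; rewrite <- Fpn_fst, Eq; reflexivity).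
    split.
    + exists k; split; [lia|]; intros j; unfold cf_r.
      now rewrite Nat.add_comm, cf_x_add, Ek.
    + intros Hex; pose proof (exceptional_periodic_eq _ _ Hex Hk Ek); lra.
Qed.

(** * Stabilizers of purely periodic points *)

Lemma P_period k n x : Fn k x = x ->
  Fn (n * k) x = x /\ P (n * k) x = mpow (P k x) n.
Proof.
  intros E; induction n as [|n [I1 I2]]; [split; reflexivity|].
  change (S n * k)%nat with (k + n * k)%nat.
  rewrite Fn_add, P_add, E, I1, I2; split; reflexivity.
Qed.

Lemma min_period x q : (1 <= q)%nat -> Fn q x = x ->
  exists k, (1 <= k)%nat /\ Fn k x = x /\
    forall m, Fn m x = x -> exists e, m = (e * k)%nat.
Proof.
  induction q as [q IH] using (well_founded_induction lt_wf); intros Hq E.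
  destruct (classic (exists k, (1 <= k < q)%nat /\ Fn k x = x)) as [(k & H1 & H2)|N].
  - apply (IH k); auto; lia.
  - exists q; split; [auto | split; [auto|]]; intros m Hm.
    exists (m / q)%nat; pose proof (Nat.div_mod m q ltac:(lia)) as D.
    pose proof (Nat.mod_upper_bound m q ltac:(lia)) as U1.
    destruct (Nat.eq_dec (m mod q) 0) as [Z|Z]; [lia|].
    exfalso; apply N; exists (m mod q)%nat; split; [lia|].
    rewrite D, Nat.mul_comm, Fn_add, (proj1 (P_period q _ x E)) in Hm; auto.
Qed.

(** Further steps complete [n] periods, after which the orbit is back at [x]. *)
Lemma periodic_tail_cancel x k m n : (1 <= k)%nat -> Fn k x = x ->
  Fn (n + m) x = Fn n x -> Fn m x = x.
Proof.
  intros Hk E H.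
  assert (T : Fn (n * k) x = x) by (now apply P_period).
  rewrite <- T at 2.
  replace (n * k)%nat with (n + (n * k - n))%nat at 1 by nia.
  rewrite Fn_add, <- H, <- Fn_add.
  replace (n + m + (n * k - n))%nat with (n * k + m)%nat by nia.
  now rewrite Fn_add, T.
Qed.

(** A stabilizing [h] carries [P n x] to [P m x] up to sign. Cancelling the shorter prefix leaves
    the product over the difference of [m] and [n], a multiple of [k], or its inverse. *)
Lemma periodic_stab_generator x k : 0 < x -> (1 <= k)%nat -> Fn k x = x ->
  (forall m, Fn m x = x -> exists e, m = (e * k)%nat) ->
  stab_generator p x (P k x).
Proof.
  intros Hx Hk E Hmin; split; [apply in_Gp_P | split].
  - apply fixes_maps; rewrite <- E at 2; apply P_maps; lra.
  - intros h Hh Hf; apply fixes_maps in Hf.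
    destruct (stabilizer_tails h x Hh Hx Hf) as (m & n & Emn & Q).
    destruct (le_lt_dec n m) as [Hle|Hlt].
    + assert (T : Fn (m - n) x = x).
      { apply (periodic_tail_cancel x k _ n); auto.
        now replace (n + (m - n))%nat with m by lia. }
      destruct (Hmin _ T) as [e He]; exists (Z.of_nat e).
      replace m with (m - n + n)%nat in Q by lia.
      rewrite P_add, T in Q; apply eqpm_cancel_r in Q; [|apply P_det].
      unfold mpowZ; replace (0 <=? Z.of_nat e)%Z with true
        by (symmetry; apply Z.leb_le; lia).
      rewrite Nat2Z.id, <- (proj2 (P_period k e x E)), <- He; exact Q.
    + assert (T : Fn (n - m) x = x).
      { apply (periodic_tail_cancel x k _ m); auto.
        now replace (m + (n - m))%nat with n by lia. }
      destruct (Hmin _ T) as [e He]; exists (- Z.of_nat e)%Z.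
      replace n with (n - m + m)%nat in Q by lia.
      rewrite P_add, T, mmul_assoc in Q.
      rewrite <- (mmul_1l (P m x)) in Q at 2.
      apply eqpm_cancel_r in Q; [|apply P_det].
      unfold mpowZ; replace (0 <=? - Z.of_nat e)%Z with false
        by (symmetry; apply Z.leb_gt; destruct e; simpl in *; lia).
      rewrite Z.opp_involutive, Nat2Z.id, <- minv_mpow.
      rewrite <- (proj2 (P_period k e x E)), <- He.
      set (g := P (n - m) x) in *.
      assert (Dg : mdet g = 1) by apply P_det.
      apply (eqpm_cancel_r _ _ g Dg); rewrite mmulVl; auto.
Qed.

Lemma periodic_simple x q : 0 < x -> (1 <= q)%nat -> Fn q x = x -> Gp_simple p x.
Proof.
  intros Hx Hq Eq; destruct (min_period x q Hq Eq) as (k & Hk & Ek & Hmin).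
  pose proof (periodic_stab_generator x k Hx Hk Ek Hmin) as SG.
  pose proof SG as (G1 & G2 & _).
  assert (Pg := posmat_P k x (Rlt_le _ _ Hx)).
  assert (Og := P_offdiag k x (Rlt_le _ _ Hx) Hk).
  set (g := P k x) in *; destruct Pg as (P1 & P2 & P3 & P4).
  assert (D := in_Gp_det g G1); unfold mdet in D.
  pose proof (proj1 (fixes_maps g x) G2) as [N1 N2].
  (* With diagonal at least 1, a zero off-diagonal entry would make [g] unipotent; not being the
     identity, it would fix no positive number. *)
  assert (Had : mb g * mc g = 0 -> ma g = 1 /\ md g = 1) by (intros Z; split; nra).
  assert (Hc : 0 < mc g).
  { destruct (Req_dec (mc g) 0) as [Z|]; [exfalso | lra].
    destruct Had as [A1 A2]; [rewrite Z; ring|].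
    rewrite A1, A2, Z in N2; lra. }
  assert (Hb : 0 < mb g).
  { destruct (Req_dec (mb g) 0) as [Z|]; [exfalso | lra].
    destruct Had as [A1 A2]; [rewrite Z; ring|].
    rewrite A1, A2, Z in N2.
    assert (0 < mc g * x * x) by (repeat apply Rmult_lt_0_compat; lra); nra. }
  assert (Hbc : 0 < mb g * mc g) by nra.
  assert (Htr : 2 < ma g + md g) by nra.
  assert (HD : (ma g + md g) ^ 2 - 4 = (2 * mc g * x + md g - ma g) ^ 2) by nra.
  (* The fixed-point equation gives [x (2cx + d - a) = c x^2 + b > 0], so [x] is the larger root. *)
  assert (Hpos : 0 <= 2 * mc g * x + md g - ma g).
  { assert (0 < mc g * x) by nra; apply (Rmult_le_reg_r x); auto; nra. }
  assert (Hroot : x = (ma g - md g + sqrt ((ma g + md g) ^ 2 - 4)) / (2 * mc g)).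
  { rewrite HD, sqrt_pow2 by auto; field; lra. }
  destruct (in_Gp_Zlam g G1) as (Z1 & Z2 & Z3 & Z4).
  exists (mc g), (md g - ma g), (- mb g); split; [split|].
  - split.
    + repeat split; auto.
      * apply in_Zlam_add; auto; now apply in_Zlam_opp.
      * now apply in_Zlam_opp.
      * nra.
    + exists x, g; repeat split; auto; try apply SG.
      exists g; repeat split; auto; try apply G2.
      unfold mtrace; rewrite Rabs_pos_eq; lra.
  - lra.
  - rewrite Hroot at 1; unfold alphaQ; f_equal.
    replace ((md g - ma g) ^ 2 - 4 * mc g * - mb g)
      with ((ma g + md g) ^ 2 - 4) by nra; ring.
Qed.

Lemma reduced_simple b i : Gp_reduced p b -> (1 <= i <= Rfloor (b / l))%Z ->
  Gp_simple p (b - IZR i * l).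
Proof.
  intros [(k & Hk & Hper) Hex] [Hi1 Hi2]; pose proof l_ge1 as Hl.
  assert (Hib : IZR i * l <= b).
  { pose proof (Rfloor_spec (b / l)); apply IZR_le in Hi2.
    replace b with (b / l * l) by (field; lra); apply Rmult_le_compat_r; lra. }
  assert (Hb : l <= b) by (apply IZR_le in Hi1; nra).
  assert (Ek : cf_x l b k = b) by (apply periodic_digits_periodic; auto).
  set (y := b - l); assert (Ey : y + l = b) by (unfold y; ring).
  destruct (Farey_of_cf k y) as (q & Hq & Eq & _); auto.
  - unfold y; lra.
  - rewrite Ey, Ek; auto.
  - rewrite Ey, Ek in Eq; fold y in Eq.
    destruct (Z_of_nat_complete (i - 1) ltac:(lia)) as [n En].
    assert (Ei : IZR i = INR n + 1) by (rewrite INR_IZR_INZ, <- En, minus_IZR; ring).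
    (* One [l] is already removed in [y]; the other [n = i - 1] are branches [S] of [F], available
       because [i l <= b]. *)
    assert (Ex : b - IZR i * l = Fn n y).
    { clear En Hi1 Hi2; rewrite Ei in *; clear Ei.
      replace (b - (INR n + 1) * l) with (y - INR n * l) by (unfold y; ring).
      assert (Hn : INR n * l <= y) by (unfold y; lra); clear Hib.
      induction n as [|n IH]; [simpl; ring|].
      rewrite FnSr, <- IH by (rewrite S_INR in Hn; lra).
      rewrite S_INR in Hn |- *; rewrite F_sub by lra; ring. }
    rewrite Ex; assert (Fq : Fn q (Fn n y) = Fn n y)
      by (rewrite <- Fn_add, Nat.add_comm, Fn_add, Eq; auto).
    apply periodic_simple with q; auto.
    destruct (Fn_ge0 n y) as [|Z]; [unfold y; lra | auto|].
    exfalso; apply Hex.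
    (* 0 is fixed by [F], so the whole cycle would be trivial *)
    assert (y0 : y = 0).
    { rewrite <- (proj1 (P_period q n y Eq)).
      replace (n * q)%nat with (n + (n * q - n))%nat by nia.
      rewrite Fn_add, <- Z; destruct digit_zero as [_ F0].
      generalize (n * q - n)%nat; induction n0 as [|m IH]; auto.
      rewrite FnSr, IH; auto. }
    replace b with l by lra; apply exceptional_l.
Qed.

End Hecke.

Theorem theorem6p2 (p : nat) (hp : (3 <= p)%nat) :
  (forall alpha alpha' : R,
     Gp_simple p alpha -> hecke_conjugate p alpha alpha' ->
     Gp_reduced p (alpha + IZR (- Rfloor (alpha' / lam p)) * lam p)) /\
  (forall x : R,
     Gp_simple p x <->
     exists (beta : R) (i : Z),
       Gp_reduced p beta /\ (1 <= i <= Rfloor (beta / lam p))%Z /\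
       x = beta - IZR i * lam p).
Proof.
  pose proof (l_ge1 p hp) as Hl; split; [|split].
  - intros x x' Hs (_ & Hne & Hconj).
    destruct (simple_elim p x Hs) as (g & y' & G1 & G2 & G3 & G4 & G5).
    pose proof (proj1 (fixes_maps _ _) (Hconj g G1 (proj2 (fixes_maps _ _) G4))) as G6.
    (* Both are the second root of the quadratic of [g], so the sum of the roots identifies them. *)
    assert (x' = y').
    { destruct G4 as [_ E1], G5 as [_ E2], G6 as [_ E3].
      assert (mc g * (x + x') = ma g - md g)
        by (apply (Rmult_eq_reg_r (x - x')); [nra | lra]).
      assert (mc g * (x + y') = ma g - md g)
        by (apply (Rmult_eq_reg_r (x - y')); [nra | lra]).
      nra. }
    subst y'; apply (simple_reduced p hp g); auto; lra.
  - intros Hs; destruct (simple_elim p x Hs) as (g & x' & G1 & G2 & G3 & G4 & G5).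
    (* The same shift serves: [x' < 0] gives [1 <= n], and [x > 0] gives the upper bound on [n]. *)
    set (n := (- Rfloor (x' / lam p))%Z).
    exists (x + IZR n * lam p), n; split; [|split].
    + apply (simple_reduced p hp g); auto; lra.
    + split.
      * pose proof (Rfloor_spec (x' / lam p)) as Hf.
        assert (E : x' / lam p * lam p = x') by (field; lra).
        assert (x' / lam p < 0) by (apply (Rmult_lt_reg_r (lam p)); lra).
        apply (Zlt_le_succ 0), lt_IZR; unfold n; rewrite opp_IZR; lra.
      * pose proof (Rfloor_spec ((x + IZR n * lam p) / lam p)) as Hf.
        assert (E : (x + IZR n * lam p) / lam p = x / lam p + IZR n) by (field; lra).
        rewrite E in Hf |- *.
        assert (0 < x / lam p) by (apply Rdiv_lt_0_compat; lra).
        apply Zlt_succ_le, lt_IZR; rewrite succ_IZR; lra.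
    + ring.
  - intros (b & i & Hb & Hi & ->); now apply reduced_simple.
Qed.
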